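(* Let $\Gamma$ be an infinite torsion-free Abelian group and let $T$ be a tree of diameter $5$ with central vertices $v_{c_1},v_{c_2}$ such that $v_{c_1}\in\Omega_{\mathfrak{s}}(T)\cup\Omega_{\mathfrak{w}}(T)$ and $v_{c_2}\notin\Omega_{\mathfrak{s}}(T)\cup\Omega_{\mathfrak{w}}(T)$. Then $T$ is not $\Gamma$-vertex magic.
   Context: Graphs are finite, simple and undirected. For an additive Abelian group $\Gamma$ with identity $0$ and a graph $G$, a $\Gamma$-vertex magic labeling is a map $\ell:V(G)\to\Gamma\setminus\{0\}$ for which there is $\mu\in\Gamma$ with $w(v)=\sum_{u\in N(v)}\ell(u)=\mu$ for every vertex $v$; $G$ is $\Gamma$-vertex magic if it has such a labeling. A pendant vertex has degree $1$. $\Omega_{\mathfrak{s}}(T)$ is the set of strong support vertices (adjacent to at least two pendant vertices) and $\Omega_{\mathfrak{w}}(T)$ the set of weak support vertices (adjacent to exactly one pendant vertex). A tree of diameter $5$ has two adjacent central vertices $v_{c_1},v_{c_2}$, the two middle vertices of any longest path. A torsion-free group has only $0$ as element of finite order. *)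

(* Defs.v *)
From mathcomp Require Import all_boot all_algebra.

Set Implicit Arguments.
Unset Strict Implicit.
Unset Printing Implicit Defensive.

Local Open Scope nat_scope.

(* A finite simple undirected graph is a finite type of vertices with an
   irreflexive symmetric adjacency relation. *)
Definition simple_graph (T : finType) (e : rel T) : Prop :=
  irreflexive e /\ symmetric e.

Definition neighbors (T : finType) (e : rel T) (v : T) : {set T} :=
  [set u | e v u]%SET.

Definition connected_graph (T : finType) (e : rel T) : Prop :=
  forall x y : T, connect e x y.

(* [ucycle] also accepts the degenerate closed walks [:: x; y] along an edge,
   hence the bound 2. *)
Definition acyclic (T : finType) (e : rel T) : Prop :=
  forall c : seq T, ucycle e c -> size c <= 2.

Definition tree (T : finType) (e : rel T) : Prop :=
  [/\ simple_graph e, connected_graph e & acyclic e].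

(* The least number of edges of a walk from x to y.  In a connected graph some
   walk has fewer than #|T| edges, so the default value #|T| is not reached. *)
Definition dist (T : finType) (e : rel T) (x y : T) : nat :=
  \big[minn/#|T|]_(n < #|T| |
     [exists p : n.-tuple T, path e x p && (last x p == y)]) n.

Definition diameter (T : finType) (e : rel T) : nat :=
  \max_(x : T) \max_(y : T) dist e x y.

(* The path with vertices x :: p has size p edges. *)
Definition simple_path (T : finType) (e : rel T) (x : T) (p : seq T) : Prop :=
  path e x p /\ uniq (x :: p).

Definition longest_path (T : finType) (e : rel T) (x : T) (p : seq T) : Prop :=
  simple_path e x p /\
  forall (y : T) (q : seq T), simple_path e y q -> size q <= size p.

(* The two indices coincide exactly when the number of edges is even. *)
Definition middle_vertices (T : finType) (x : T) (p : seq T) : {set T} :=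
  [set nth x (x :: p) (size p)./2; nth x (x :: p) (uphalf (size p))]%SET.

Definition central_vertices (T : finType) (e : rel T) (c1 c2 : T) : Prop :=
  forall (x : T) (p : seq T),
    longest_path e x p -> middle_vertices x p = [set c1; c2]%SET.

Definition pendants (T : finType) (e : rel T) : {set T} :=
  [set v | #|neighbors e v| == 1]%SET.

Definition strong_support (T : finType) (e : rel T) : {set T} :=
  [set v | 2 <= #|neighbors e v :&: pendants e|]%SET.

Definition weak_support (T : finType) (e : rel T) : {set T} :=
  [set v | #|neighbors e v :&: pendants e| == 1]%SET.

Definition torsion_free (Gamma : zmodType) : Prop :=
  forall (x : Gamma) (n : nat), 0 < n -> (x *+ n = 0)%R -> x = 0%R.

Definition vertex_magic_labeling (Gamma : zmodType) (T : finType) (e : rel T)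
    (l : T -> Gamma) : Prop :=
  (forall v : T, l v != 0%R) /\
  exists mu : Gamma, forall v : T, (\sum_(u in neighbors e v) l u)%R = mu.

Definition vertex_magic (Gamma : zmodType) (T : finType) (e : rel T) : Prop :=
  exists l : T -> Gamma, vertex_magic_labeling e l.

(* Main.v *)
(** Every support vertex carries the magic constant [mu], since it is the only
    neighbour of a pendant vertex.  No path has more than 5 edges, so, as [c2]
    has no pendant neighbour, all its neighbours other than [c1] are support
    vertices; so is [c1].  Hence the weight of [c2] is [deg c2 * mu = mu] with
    [deg c2 >= 2], which contradicts torsion-freeness because [mu <> 0]. *)
Require Import Defs.
From mathcomp Require Import all_boot all_algebra.
From mathcomp Require Import all_classical.

Set Implicit Arguments.
Unset Strict Implicit.
Unset Printing Implicit Defensive.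

Lemma bigminn_le (I : eqType) (r : seq I) (P : pred I) (F : I -> nat) d j :
  j \in r -> P j -> \big[minn/d]_(i <- r | P i) F i <= F j.
Proof.
elim: r => // i r IHr; rewrite inE big_cons => /orP[/eqP<- ->|jr Pj].
  exact: geq_minl.
case: ifP => _; last exact: IHr.
exact: leq_trans (geq_minr _ _) (IHr jr Pj).
Qed.

Section Trees.

Variables (T : finType) (e : rel T).
Hypothesis e_tree : tree e.

Lemma tree_sym : symmetric e. Proof. by case: e_tree => -[]. Qed.

Lemma tree_irr : irreflexive e. Proof. by case: e_tree => -[]. Qed.

(** If [y] lay on [p] beyond its head, the initial segment of [p] ending at [y] would close up
    through the edge [y x] to a cycle. For empty [p] the default head [x] makes the last condition
    automatic. *)
Lemma simple_path_cons x p y :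
  simple_path e x p -> e x y -> y != head x p -> simple_path e y (x :: p).
Proof.
case=> pth unq xy yh; split; first by rewrite /= tree_sym xy.
rewrite cons_uniq unq andbT inE negb_or; apply/andP; split.
  by apply: contraTneq xy => ->; rewrite tree_irr.
apply/negP => yp; case/splitPr: p / yp => p1 p2 in pth unq yh *.
(* Since [y] is not the head, [p1] is nonempty, so the closed walk has at least three vertices and
   exceeds the bound 2 of [acyclic]. *)
case: p1 => [|a p1] in pth unq yh *; first by rewrite eqxx in yh.
have [_ _ /(_ (x :: rcons (a :: p1) y)) acyc] := e_tree.
suff /acyc : ucycle e (x :: rcons (a :: p1) y) by rewrite /= size_rcons.
move: pth unq; rewrite -cat_rcons cat_path -cat_cons cat_uniq.
move=> /andP[pth _] /andP[unq _]; rewrite /ucycle unq andbT /cycle rcons_path pth.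
by rewrite last_rcons tree_sym.
Qed.

(* A walk from [x] either starts along [p], which shortens both, or its first
   step extends [p] backwards to a longer simple path. *)
Lemma simple_path_size_le x p q :
  simple_path e x p -> path e x q -> last x q = last x p -> size p <= size q.
Proof.
elim: q x p => [|b q IHq] x p.
  by case: p => // a p [_ unq] _ /= eq_last; rewrite /= eq_last mem_last in unq.
move=> xp /= /andP[xb bq] eq_last.
have [bh|bh] := eqVneq b (head x p); last first.
  by have /ltnW/leqW := IHq _ _ (simple_path_cons xp xb bh) bq eq_last.
case: p => // a p in xp eq_last bh *.
rewrite /= in bh eq_last; subst a; rewrite ltnS; apply: IHq bq eq_last.
by case: xp => /= /andP[_ ?] /andP[_ ?]; split.
Qed.

Lemma dist_simple_path x p : simple_path e x p -> dist e x (last x p) = size p.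
Proof.
move=> xp; have [pth unq] := xp.
have szp : size p < #|T|.
  by have /card_uniqP /= <- := unq; apply: max_card.
apply/eqP; rewrite eqn_leq; apply/andP; split.
  apply: (bigminn_le (@nat_of_ord _) _ (mem_index_enum (Ordinal szp))).
  by apply/existsP; exists (in_tuple p); rewrite /= pth eqxx.
(* The lower bound must also hold for the default value [#|T|] of the minimum, which [szp]
   ensures. *)
apply: (big_ind (leq (size p))) => [|m n mp np|n]; first exact: ltnW.
  by rewrite leq_min mp np.
move=> /existsP[q /andP[xq /eqP lq]].
by rewrite -(size_tuple q); apply: simple_path_size_le xp xq lq.
Qed.

Lemma simple_path_diameter x p : simple_path e x p -> size p <= diameter e.
Proof.
move=> /dist_simple_path <-; rewrite /diameter.
apply: leq_trans (leq_bigmax x).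
exact: (leq_bigmax (F := fun y => dist e x y)).
Qed.

Lemma simple_path_exists x y :
  exists2 p, simple_path e x p & last x p = y.
Proof.
have [_ /(_ x y)/connectP[p pth ->] _] := e_tree.
by case: (shortenP pth) => p' pth' unq' _; exists p'.
Qed.

(** A simple path joining a pair at maximal distance works, because simple paths are geodesics. The
    vertex [x0] ensures that the maxima are attained. *)
Lemma diameter_path (x0 : T) : exists x p, longest_path e x p /\ size p = diameter e.
Proof.
have T_gt0 : 0 < #|T| by apply/card_gt0P; exists x0.
rewrite /diameter.
have [x dx] := eq_bigmax (fun x => \max_(y : T) dist e x y) T_gt0.
have [y dy] := eq_bigmax (fun y => dist e x y) T_gt0.
have [p xp lp] := simple_path_exists x y.
have szp : size p = diameter e.
  by rewrite -(dist_simple_path xp) lp /diameter dx dy.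
exists x, p; split=> //; split=> // z q zq.
by rewrite szp; apply: simple_path_diameter zq.
Qed.

Lemma nonpendant_neighbor u v :
  e u v -> u \notin pendants e -> exists2 w, e u w & w != v.
Proof.
move=> uv; rewrite inE => np.
have vN : v \in neighbors e u by rewrite inE.
have : 0 < #|neighbors e u :\ v|%SET.
  by move: np; rewrite (cardsD1 v) vN add1n eqSS lt0n.
by case/card_gt0P=> w; rewrite !inE => /andP[wv uw]; exists w.
Qed.

Lemma simple_path_rev x p :
  simple_path e x p -> simple_path e (last x p) (rev (belast x p)).
Proof.
case=> pth unq; split.
  by rewrite rev_path (eq_path (e' := e)) // => a b; rewrite tree_sym.
by rewrite -rev_rcons -lastI rev_uniq.
Qed.

Lemma in_supportP c :
  reflect (exists2 v, e c v & v \in pendants e)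
          (c \in strong_support e :|: weak_support e)%SET.
Proof.
have -> : (c \in strong_support e :|: weak_support e)%SET
          = (0 < #|neighbors e c :&: pendants e|)%SET.
  by rewrite !inE; case: #|_| => [|[]].
apply: (iffP card_gt0P) => [[v]|[v cv pv]].
  by rewrite !inE => /andP[cv pv]; exists v; rewrite ?inE.
by exists v; rewrite finset.inE pv finset.inE cv.
Qed.

(** A longest path, oriented so that [c2] precedes [c1], reads [y d c2 c1 a b]: it supplies both the
    tail beyond [c1] and a second neighbour [d] of [c2]. *)
Lemma central_path c1 c2 :
    diameter e = 5 -> central_vertices e c1 c2 -> c1 != c2 ->
  exists a b d, [/\ simple_path e c2 [:: c1; a; b], e c2 d & d != c1].
Proof.
move=> diam cent c12.
have [x [p [xp szp]]] := diameter_path c1.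
rewrite diam in szp.
have := cent x p xp; case: xp => xp _.
case: p szp xp => [|x1 [|x2 [|x3 [|x4 [|x5 []]]]]] //= _ xp.
rewrite /middle_vertices /= => mid.
have c1m : c1 \in [set x2; x3]%SET by rewrite mid !inE eqxx.
have c2m : c2 \in [set x2; x3]%SET by rewrite mid !inE eqxx orbT.
have drop2 y y1 y2 q :
  simple_path e y [:: y1, y2 & q] ->
  [/\ simple_path e y2 q, e y2 y1 & y1 \notin q].
  case=> /= /and3P[_ y12 pth] /and3P[_].
  rewrite inE negb_or => /andP[_ y1q] unq.
  by split; [split | rewrite tree_sym |].
have main y y1 y4 y5 :
    simple_path e y [:: y1; c2; c1; y4; y5] ->
  exists a b d, [/\ simple_path e c2 [:: c1; a; b], e c2 d & d != c1].
  move=> /drop2[? ? ]; rewrite !inE !negb_or => /andP[? _].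
  by exists y4, y5, y1.
(* The middle vertices are [x2] and [x3]; if [c1] comes first, the path is reversed. *)
have [/eqP c1x|c1x] := boolP (c1 == x2); last first.
  have /eqP c1x3 : c1 == x3 by move: c1m; rewrite !inE (negbTE c1x).
  have /eqP c2x2 : c2 == x2.
    by move: c2m; rewrite !inE -c1x3 [c2 == c1]eq_sym (negbTE c12) orbF.
  by subst x2 x3; apply: main xp.
have /eqP c2x3 : c2 == x3.
  by move: c2m; rewrite !inE -c1x [c2 == c1]eq_sym (negbTE c12).
by subst x2 x3; apply: main (simple_path_rev xp).
Qed.

(* If no neighbour of [u] were pendant, [c2 c1 a b] could be extended backwards
   by [u] and two further vertices to a path with 6 edges. *)
Lemma central_neighbor_support c1 c2 a b u :
    diameter e = 5 -> simple_path e c2 [:: c1; a; b] ->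
    (c2 \notin strong_support e :|: weak_support e)%SET ->
    e c2 u -> u != c1 ->
  (u \in strong_support e :|: weak_support e)%SET.
Proof.
move=> diam cp c2ns c2u uc1; apply/in_supportP.
have up := simple_path_cons cp c2u uc1.
have uc2 : e u c2 by rewrite tree_sym.
have unp : u \notin pendants e.
  by apply: contra c2ns => pu; apply/in_supportP; exists u.
have [w uw wc2] := nonpendant_neighbor uc2 unp.
have wp := simple_path_cons up uw wc2.
exists w => //; apply/negPn/negP => np.
have wu : e w u by rewrite tree_sym.
have [z wz zu] := nonpendant_neighbor wu np.
by have /simple_path_diameter := simple_path_cons wp wz zu; rewrite diam.
Qed.

Lemma magic_support (Gamma : zmodType) (l : T -> Gamma) (mu : Gamma) c :
    (forall v, \sum_(u in neighbors e v) l u = mu)%R ->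
    (c \in strong_support e :|: weak_support e)%SET ->
  l c = mu.
Proof.
move=> lmu /in_supportP[v cv]; rewrite inE => /cards1P[s Nv].
have : c \in neighbors e v by rewrite inE tree_sym.
by rewrite -(lmu v) Nv big_set1 inE => /eqP ->.
Qed.

End Trees.

Theorem theorem4p6 (Gamma : zmodType) (T : finType) (e : rel T) (c1 c2 : T)
    (Gamma_inf : infinite_set [set: Gamma]%classic)
    (Gamma_tf : torsion_free Gamma)
    (T_tree : tree e)
    (T_diam : diameter e = 5)
    (c_central : central_vertices e c1 c2)
    (c1_support : c1 \in (strong_support e :|: weak_support e)%SET)
    (c2_nsupport : c2 \notin (strong_support e :|: weak_support e)%SET) :
  ~ vertex_magic Gamma e.
Proof.
case=> l [l_neq0 [mu lmu]].
have c12 : c1 != c2 by apply: contraNneq c2_nsupport => <-.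
have [a [b [d [cp c2d dc1]]]] := central_path T_tree T_diam c_central c12.
have c2c1 : e c2 c1 by case: cp => /= /andP[].
have lc1 := magic_support T_tree lmu c1_support.
have lN u : u \in neighbors e c2 -> l u = mu.
  rewrite inE => c2u; have [-> //|uc1] := eqVneq u c1.
  exact: (magic_support T_tree lmu
            (central_neighbor_support T_tree T_diam cp c2_nsupport c2u uc1)).
have := lmu c2; rewrite (eq_bigr _ lN) GRing.sumr_const.
have c1N : c1 \in neighbors e c2 by rewrite inE.
(* Splitting off the term of [c1] and cancelling [mu] leaves a multiple of [mu] equal to 0. The
   multiplier counts the neighbours of [c2] other than [c1], and is positive because of [d]. *)
rewrite (cardsD1 c1) c1N GRing.mulrS => /(canRL (GRing.addKr _)).
rewrite GRing.addNr => /Gamma_tf mu0.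
move/eqP: (l_neq0 c1); apply; rewrite lc1; apply: mu0.
by apply/card_gt0P; exists d; rewrite !inE dc1.
Qed.
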